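(* Let $B,\bar B$ be real or complex vector spaces and $L(\varepsilon)=\sum_{i=0}^\infty\varepsilon^iL_i$ a formal power series with $L_i\in L(B,\bar B)$, $L(\varepsilon)\not\equiv0$. Then the recursion of the context is well defined at every stage $k+1$, $k\ge0$, and for any choice of complements the following hold. (i) For every $k\ge0$, the kernel of $\Delta^{k+1}\in L(B^{k+1},\bar B^{k+1})$ is the range of $M^{(k+1)}\in L(B^{k+1},B^{k+1})$ restricted to $N_1\times\cdots\times N_{k+1}$: $$N[\Delta^{k+1}]=R\big[M^{(k+1)}|_{N_1\times\cdots\times N_{k+1}}\big]=\begin{pmatrix} I_B \\ 0 \\ 0 \\ \vdots \\ 0 \end{pmatrix}N_1\oplus\begin{pmatrix} M_{1,2} \\ I_B \\ 0 \\ \vdots \\ 0 \end{pmatrix}N_2\oplus\cdots\oplus\begin{pmatrix} M_{1,k+1} \\ M_{2,k+1} \\ \vdots \\ M_{k,k+1} \\ I_B \end{pmatrix}N_{k+1}.$$ (ii) For every $k\ge0$ and $b_0\in B$: $\mathrm{rank}(b_0)\ge k\Leftrightarrow b_0\in N_k$; $\mathrm{rank}(b_0)=k\Leftrightarrow b_0\in N_k\setminus N_{k+1}$; and $\mathrm{rank}(b_0)=k$ whenever $b_0\in N_{k+1}^c\subset N_k$, $b_0\ne0$. (iii) For every $k\ge0$, stabilization of $L(\varepsilon)$ at $k$ is equivalent to each of the following conditions: - $N_{k+1}^c\ne\{0\}$ and $N_{k+l}^c=\{0\}$ for all $l\ge2$; - $R_{k+1}\ne\{0\}$ and $R_{k+l}=\{0\}$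 for all $l\ge2$; - $N_k\supsetneq N_{k+1}=N_{k+l}$ for all $l\ge2$.
   Context: $L(X,Y)$ denotes the linear maps from $X$ to $Y$; $N[T]$ and $R[T]$ are the kernel and range of $T$; $I_X$ is the identity. Rank and stabilization. For $k\ge1$ let $\Delta^k:B^k\to\bar B^k$ be the upper triangular block Toeplitz operator with $(i,j)$ entry $L_{j-i}$ for $j\ge i$ and $0$ otherwise, so that $\Delta^k(b_{k-1},\dots,b_0)^T=0$ iff $\sum_{i+j=m}L_ib_j=0$ for $m=0,\dots,k-1$. For $b_0\in B$ put $\mathrm{rank}(b_0)=0$ if $b_0\notin N[L_0]$, and otherwise $\mathrm{rank}(b_0)=\sup\{k\ge1\mid\exists (b_{k-1},\dots,b_0)\in B^k:\ \Delta^k(b_{k-1},\dots,b_0)^T=0\}\in\mathbb{N}\cup\{\infty\}$. $L(\varepsilon)$ stabilizes at $k\ge0$ if $\mathrm{rank}(b_0)\in\{0,\dots,k\}\cup\{\infty\}$ for all $b_0\in B$ and there exists $b_0$ with $\mathrm{rank}(b_0)=k$. Recursion. Put $N_0:=B$, $N_0^c:=\{0\}$, $R_0:=\{0\}$, $R_0^c:=\bar B$, $\bar S_1:=S_1:=L_0$, $E_{1,1}:=M_{1,1}:=I_B$. At each stage $j\ge1$, given $S_j\in L(B,R_{j-1}^c)$, set $N_j:=\{n\in N_{j-1}\mid S_jn=0\}$, $R_j:=S_j(N_{j-1})$ and choose algebraic direct complements $N_{j-1}=N_j^c\oplus N_j$, $R_{j-1}^c=R_j\oplus R_j^c$. Then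 $B=N_1^c\oplus\cdots\oplus N_j^c\oplus N_j$ and $\bar B=R_1\oplus\cdots\oplus R_j\oplus R_j^c$; $\mathcal P_j$ denotes the projection of $\bar B$ onto $R_j$ defined by the latter decomposition, and $S_j^{-1}:R_j\to N_j^c$ denotes the inverse of the bijection $S_j|_{N_j^c}:N_j^c\to R_j$. At stage $j\ge2$, the operators are defined by $$\bar S_j:=\sum_{i=1}^{j-1}L_iM_{i,j-1},\qquad S_j:=(I_{\bar B}-\mathcal P_1-\cdots-\mathcal P_{j-1})\bar S_j,$$ $$E_{j,j}:=I_B,\qquad E_{i,j}:=-S_i^{-1}\mathcal P_i\sum_{\nu=i+1}^{j}\bar S_\nu E_{\nu,j}\quad (i=j-1,\dots,1),$$ $$M_{1,j}:=E_{1,j},\qquad M_{i,j}:=\sum_{\nu=i}^{j}M_{i-1,\nu-1}E_{\nu,j}\quad(i=2,\dots,j).$$ (So $M_{j,j}=I_B$.) $M^{(k+1)}$ is the upper triangular $(k+1)\times(k+1)$ operator matrix with entries $M_{i,j}$ for $i\le j$ and $0$ for $i>j$. *)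

(* Defs.v *)
From HB Require Import structures.
From mathcomp Require Import all_boot all_order all_algebra.
From mathcomp Require Import all_classical all_reals ereal.
From mathcomp Require Import complex.

Set Implicit Arguments.
Unset Strict Implicit.
Unset Printing Implicit Defensive.

Import GRing.Theory.
Local Open Scope classical_set_scope.
Local Open Scope ring_scope.

Variant real_or_complex (R : realType) : fieldType -> Prop :=
| RealScalars : real_or_complex R R
| ComplexScalars : real_or_complex R R[i].

Section DirectSums.
Variables (K : fieldType) (V : lmodType K).

Definition subspace (A : set V) : Prop := submod_closed (mem A).

(* W = A (+) C *)
Definition complements (W A C : set V) : Prop :=
  [/\ subspace A, subspace C, W = [set a + c | a in A & c in C]
    & A `&` C = [set 0]].

Definition selection (I : finType) (F : I -> set V) : set {ffun I -> V} :=
  [set x | forall i, F i (x i)].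

(* W is the internal direct sum of the F i *)
Definition direct_sum (I : finType) (W : set V) (F : I -> set V) : Prop :=
  [/\ forall i, subspace (F i),
      W = [set \sum_i x i | x in selection F]
    & {in selection F &, injective (fun x : {ffun I -> V} => \sum_i x i)}].

(* The F i0-component of y; meaningful when V is the direct sum of the F i,
   by default 0 when y has no decomposition. *)
Definition component (I : finType) (F : I -> set V) (i0 : I) (y : V) : V :=
  xget 0 [set x | selection F x /\ \sum_i x i = y] i0.

(* The family A_1, ..., A_j, C_j, indexed from 0. *)
Definition chain (A C : nat -> set V) (j : nat) (i : 'I_j.+1) : set V :=
  if (i < j)%N then A i.+1 else C j.

End DirectSums.

Arguments chain {K V} A C j i.

Section BlockOperators.
Variables (K : fieldType) (B B' : lmodType K).

Definition block_op (n : nat) (A : 'I_n -> 'I_n -> B -> B')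
    (v : {ffun 'I_n -> B}) : {ffun 'I_n -> B'} :=
  [ffun i => \sum_j A i j (v j)].

End BlockOperators.

Section Rank.
Variables (R : realType) (K : fieldType) (B B' : lmodType K).
Variable L : nat -> {linear B -> B'}.

(* The entry of index j of the argument is b_(k-1-j): b_0 comes last. *)
Definition Delta (k : nat) : {ffun 'I_k -> B} -> {ffun 'I_k -> B'} :=
  block_op (fun i j : 'I_k => if (i <= j)%N then L (j - i)%N : B -> B' else \0).

Definition rank (b0 : B) : \bar R :=
  if L 0%N b0 == 0 then
    ereal_sup [set (k.+1%:R)%:E | k in
      [set k | exists2 b : {ffun 'I_k.+1 -> B}, b ord_max = b0 & Delta b = 0]]
  else 0%E.

Definition stabilizes_at (k : nat) : Prop :=
  (forall b0, (exists2 m : nat, (m <= k)%N & rank b0 = (m%:R)%:E)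
              \/ rank b0 = +oo%E)
  /\ exists b0, rank b0 = (k%:R)%:E.

End Rank.

(* The sequences N_j^c and R_j^c; see [admissible] below. *)
Record choices (K : fieldType) (B B' : lmodType K) := Choices {
  Nc : nat -> set B;
  Rc : nat -> set B' }.

(* Since every stage uses all the previous ones, the recursion is run on tables
   indexed by the stage; the tables E and M are indexed by columns, so that
   [tabE h j i] is E_(i,j). The equations of the recursion are the lemmas
   proved at the end of the section. *)
Section Recursion.
Variables (K : fieldType) (B B' : lmodType K).
Variables (L : nat -> {linear B -> B'}) (c : choices B B').

Record tables := Tables {
  tabSbar : nat -> B -> B';
  tabS : nat -> B -> B';
  tabN : nat -> set B;
  tabR : nat -> set B';
  tabE : nat -> nat -> B -> B;
  tabM : nat -> nat -> B -> B }.

Definition proj_of (tR : nat -> set B') (i : nat) : B' -> B' :=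
  component (chain tR (Rc c) i) (inord i.-1).

Definition inv_of (tS : nat -> B -> B') (i : nat) : B' -> B :=
  'pinv_(fun=> 0) (Nc c i) (tS i).

(* [colE tSbar tS tR j d i] is E_(i,j) for j - d <= i <= j. *)
Fixpoint colE tSbar tS tR (j d : nat) : nat -> B -> B :=
  if d is d'.+1 then
    let e := colE tSbar tS tR j d' in
    [eta e with (j - d)%N |-> fun b =>
      - inv_of tS (j - d) (proj_of tR (j - d)
          (\sum_((j - d).+1 <= nu < j.+1) tSbar nu (e nu b)))]
  else fun=> id.

Definition next_stage (j : nat) (h : tables) : tables :=
  let Sbar_j b :=
    if j == 1%N then L 0%N b else \sum_(1 <= i < j) L i (tabM h j.-1 i b) in
  let S_j b := Sbar_j b - \sum_(1 <= i < j) proj_of (tabR h) i (Sbar_j b) in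
  let tSbar := [eta tabSbar h with j |-> Sbar_j] in
  let tS := [eta tabS h with j |-> S_j] in
  let tR := [eta tabR h with j |-> S_j @` tabN h j.-1] in
  let E_j := colE tSbar tS tR j j.-1 in
  let M_j i b :=
    if i == 1%N then E_j 1%N b
    else \sum_(i <= nu < j.+1) tabM h nu.-1 i.-1 (E_j nu b) in
  Tables tSbar tS
    [eta tabN h with j |-> [set n | tabN h j.-1 n /\ S_j n = 0]] tR
    [eta tabE h with j |-> E_j] [eta tabM h with j |-> M_j].

Fixpoint run (j : nat) : tables :=
  if j is j'.+1 then next_stage j (run j')
  else Tables (fun=> \0) (fun=> \0) (fun=> setT) (fun=> [set 0])
         (fun _ _ => id) (fun _ _ => id).

Definition opSbar j := tabSbar (run j) j.
Definition opS j := tabS (run j) j.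
Definition spN j := tabN (run j) j.
Definition spR j := tabR (run j) j.
Definition opE i j := tabE (run j) j i.
Definition opM i j := tabM (run j) j i.
Definition projR j := proj_of spR j.
Definition invS j := inv_of opS j.

Lemma run_stable i j : (i <= j)%N ->
  [/\ tabSbar (run j) i = opSbar i, tabS (run j) i = opS i,
      tabN (run j) i = spN i, tabR (run j) i = spR i &
      tabE (run j) i = opE^~ i /\ tabM (run j) i = opM^~ i].
Proof.
elim: j => [|j IH]; first by rewrite leqn0 => /eqP ->.
rewrite leq_eqVlt => /orP[/eqP ->//|]; rewrite ltnS => lij.
have nij : (i == j.+1) = false by apply/negbTE; rewrite neq_ltn ltnS lij.
by have := IH lij; rewrite /= nij.
Qed.

Lemma proj_of_ext (tR tR' : nat -> set B') i :
  (forall l, (l <= i)%N -> tR l = tR' l) -> proj_of tR i = proj_of tR' i.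
Proof.
move=> h; rewrite /proj_of; congr (component _ _).
by apply/funext => l; rewrite /chain; case: ifP => // /h.
Qed.

Lemma proj_run i j : (i <= j)%N -> proj_of (tabR (run j)) i = projR i.
Proof.
move=> lij; apply: proj_of_ext => l lli.
by have [] := run_stable (leq_trans lli lij).
Qed.

Lemma spN0 : spN 0 = setT. Proof. by []. Qed.
Lemma spR0 : spR 0 = [set 0]. Proof. by []. Qed.

Lemma opSbar1 : opSbar 1 = L 0%N.
Proof. by rewrite /opSbar /=; apply/funext. Qed.

Lemma opSbarE j b : (2 <= j)%N ->
  opSbar j b = \sum_(1 <= i < j) L i (opM i j.-1 b).
Proof. by case: j => [//|[//|j]] _; rewrite /opSbar /= eqxx. Qed.

Lemma opSE j b : (1 <= j)%N ->
  opS j b = opSbar j b - \sum_(1 <= i < j) projR i (opSbar j b).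
Proof.
case: j => [//|j] _; rewrite /opS /opSbar /= eqxx; congr (_ - _).
by apply: eq_big_nat => i /andP[_ lij]; rewrite proj_run.
Qed.

Lemma spNE j : spN j.+1 = [set n | spN j n /\ opS j.+1 n = 0].
Proof. by rewrite /spN /opS /= eqxx. Qed.

Lemma spRE j : spR j.+1 = opS j.+1 @` spN j.
Proof. by rewrite /spR /opS /= eqxx. Qed.

Lemma colE_stable tSbar tS tR j d d' i : (j - d <= i <= j)%N -> (d <= d' <= j)%N ->
  colE tSbar tS tR j d' i = colE tSbar tS tR j d i.
Proof.
move=> /andP[li lj] /andP[]; elim: d' => [|d' IH].
  by rewrite leqn0 => /eqP ->.
rewrite leq_eqVlt => /orP[/eqP ->//|]; rewrite ltnS => ldd ld'j.
rewrite -IH ?(ltnW ld'j) //=.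
have -> // : (i == j - d'.+1)%N = false.
apply/negbTE; rewrite neq_ltn; apply/orP; right; apply: leq_trans li.
by rewrite ltn_sub2l // (leq_trans _ ld'j) // ltnS.
Qed.

Lemma colES tSbar tS tR j d i b : (j - d.+1)%N = i ->
  colE tSbar tS tR j d.+1 i b = - inv_of tS i (proj_of tR i
    (\sum_(i.+1 <= nu < j.+1) tSbar nu (colE tSbar tS tR j d nu b))).
Proof. by move=> <-; rewrite /= eqxx. Qed.

Lemma opE_colE j d i : (j.+1 - d <= i <= j.+1)%N -> (d <= j)%N ->
  opE i j.+1 = colE (tabSbar (run j.+1)) (tabS (run j.+1)) (tabR (run j.+1))
    j.+1 d i.
Proof.
by move=> li ld; rewrite /opE /= eqxx; apply: colE_stable; rewrite ?ld ?leqnSn.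
Qed.

Lemma opE_diag j : (1 <= j)%N -> opE j j = id.
Proof. by case: j => [//|j] _; rewrite (@opE_colE _ 0%N) ?subn0 ?leqnn. Qed.

Lemma opEE i j b : (1 <= i < j)%N ->
  opE i j b =
  - invS i (projR i (\sum_(i.+1 <= nu < j.+1) opSbar nu (opE nu j b))).
Proof.
case: j => [|j /andP[i0 lij]]; first by case/andP.
have [d Ed] : exists d, (j.+1 - i)%N = d.+1.
  by exists (j.+1 - i).-1; rewrite prednK // subn_gt0.
have Ei : (j.+1 - d.+1)%N = i by rewrite -Ed subKn // ltnW.
have ldj : (d.+1 <= j)%N by rewrite -Ed leq_subLR -add1n leq_add2r.
rewrite (@opE_colE _ d.+1) ?Ei ?leqnn ?(ltnW lij) //.
rewrite (colES _ _ _ _ Ei); congr (- _).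
have [_ tSi _ _ _] := run_stable (ltnW lij).
rewrite /inv_of tSi proj_run ?(ltnW lij) // -/(inv_of opS i) -/(invS i).
congr (invS i (projR i _)); apply: eq_big_nat => nu /andP[ln lnj].
have [-> _ _ _ _] := run_stable (lnj : (nu <= j.+1)%N).
by rewrite (@opE_colE _ d) ?(ltnW ldj) // subSn ?(ltnW ldj) // -subSS Ei ln.
Qed.

Lemma opM1 j : (1 <= j)%N -> opM 1 j = opE 1 j.
Proof. by case: j => [//|j] _; rewrite /opM /opE /= !eqxx. Qed.

Lemma opME i j b : (2 <= i <= j)%N ->
  opM i j b = \sum_(i <= nu < j.+1) opM i.-1 nu.-1 (opE nu j b).
Proof.
case: j => [|j /andP[i2 lij]]; first by case: i => // i /andP[].
have ni1 : (i == 1%N) = false by case: i i2 {lij} => [|[]].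
rewrite {1}/opM /= eqxx ni1; apply: eq_big_nat => nu /andP[ln lnj].
have lnj' : (nu.-1 <= j)%N by case: nu lnj {ln}.
have [_ _ _ _ [_ ->]] := run_stable lnj'.
by rewrite /opE /= eqxx.
Qed.

(* Complements chosen at the stages 1, ..., n; nothing is required beyond. *)
Definition admissible (n : nat) : Prop :=
  [/\ Nc c 0 = [set 0], Rc c 0 = setT
    & forall j, (j < n)%N ->
        complements (spN j) (Nc c j.+1) (spN j.+1)
        /\ complements (Rc c j) (spR j.+1) (Rc c j.+1)].

(* M^(k+1); the index i : 'I_k.+1 stands for i.+1 *)
Definition Mmx (k : nat) : {ffun 'I_k.+1 -> B} -> {ffun 'I_k.+1 -> B} :=
  block_op (fun i j : 'I_k.+1 =>
    if (i <= j)%N then opM i.+1 j.+1 else \0).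

(* The column (M_(1,j), ..., M_(j-1,j), I_B, 0, ..., 0)^T *)
Definition Mcol (k : nat) (j : 'I_k.+1) (n : B) : {ffun 'I_k.+1 -> B} :=
  [ffun i : 'I_k.+1 =>
    if (i < j)%N then opM i.+1 j.+1 n else if i == j then n else 0].

End Recursion.

(* Main.v *)
From Pilot Require Import Defs.
From HB Require Import structures.
From mathcomp Require Import all_boot all_order all_algebra.
From mathcomp Require Import all_classical all_reals ereal.
From mathcomp Require Import complex.

Set Implicit Arguments.
Unset Strict Implicit.
Unset Printing Implicit Defensive.

Import Order.TTheory GRing.Theory Num.Theory.
Local Open Scope classical_set_scope.
Local Open Scope ring_scope.

(* MathComp has other objects with these names. *)
Local Notation subspace := Pilot.Defs.subspace.
Local Notation invS := Pilot.Defs.invS.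
Local Notation colE := Pilot.Defs.colE.

(* A vector (v_1, ..., v_(k+1)) lies in the kernel of Delta^(k+1) iff its tail
   lies in the kernel of Delta^k and its first row vanishes. Writing the tail
   as M^(k) (n_1, ..., n_k) and putting m_1 = v_1, m_(nu+1) = n_nu, the first row
   becomes sum_nu Sbar_nu m_nu = 0 with m_nu in N_(nu-1). On N_(nu-1) the operator
   Sbar_nu takes its values in R_1 + ... + R_nu, with R_nu-component S_nu, so the
   equation splits into S_i m_i = - P_i sum_(nu > i) Sbar_nu m_nu for all i, which
   is solved from the last index upwards by m = E n with n_i in N_i. By definition
   M^(k+1) is the composition of 1 + M^(k) with E. As M is unipotent, the last
   entries of the kernel of Delta^k fill N_k, which computes the rank; the
   stabilization criteria only compare consecutive N_k. *)

(** * Sums over triangular index ranges *)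

Lemma big_ord_upper (V : nmodType) k (i : nat) (F : nat -> V) :
  \sum_(j < k) (if (i <= j)%N then F j else 0) = \sum_(i <= j < k) F j.
Proof. by rewrite big_geq_mkord -big_mkcond. Qed.

Lemma big_nat_triangle (V : nmodType) (i n : nat) (F : nat -> nat -> V) :
  \sum_(i <= a < n) \sum_(a <= b < n) F a b =
  \sum_(i <= b < n) \sum_(i <= a < b.+1) F a b.
Proof.
elim: n => [|n IH]; first by rewrite !big_geq.
have [lin|lni] := leqP i n; last by rewrite !big_geq.
rewrite [LHS]big_nat_recr // [RHS]big_nat_recr //= -IH big_nat1.
rewrite [X in _ = _ + X]big_nat_recr //= addrA; congr (_ + _).
rewrite -big_split /=; apply: eq_big_nat => a /andP[_ lan].
by rewrite big_nat_recr // ltnW.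
Qed.

(** * Linearity of plain functions *)

Section LinearFunctions.
Variables (K : fieldType) (U V W : lmodType K).

Section Values.
Variables (f : U -> V) (hf : linear f).

(** The operators of the recursion are plain functions, known to be linear only for admissible
    choices. Packing such an [f] locally gives access to the lemmas on bundled linear maps. *)
Let g : {linear U -> V} := HB.pack f (GRing.isLinear.Build K U V *:%R f hf).

Lemma linear_fun0 : f 0 = 0. Proof. exact: (linear0 g). Qed.
Lemma linear_funD u v : f (u + v) = f u + f v. Proof. exact: (linearD g). Qed.
Lemma linear_funB u v : f (u - v) = f u - f v. Proof. exact: (linearB g). Qed.
Lemma linear_fun_sum (I : Type) (r : seq I) (P : pred I) (F : I -> U) :
  f (\sum_(i <- r | P i) F i) = \sum_(i <- r | P i) f (F i).
Proof. exact: (linear_sum g). Qed.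

End Values.

Lemma linear_fun_comp (f : V -> W) (g : U -> V) :
  linear f -> linear g -> linear (fun u => f (g u)).
Proof. by move=> hf hg a u v; rewrite hg hf. Qed.

Lemma linear_fun_opp (f : U -> V) : linear f -> linear (fun u => - f u).
Proof. by move=> hf a u v; rewrite hf opprD scalerN. Qed.

Lemma linear_fun_sub (f g : U -> V) :
  linear f -> linear g -> linear (fun u => f u - g u).
Proof.
move=> hf hg a u v; rewrite hf hg opprD scalerBr !addrA.
by congr (_ + _); rewrite addrAC.
Qed.

Lemma linear_fun_bigsum (I : eqType) (r : seq I) (F : I -> U -> V) :
  (forall i, i \in r -> linear (F i)) -> linear (fun u => \sum_(i <- r) F i u).
Proof.
move=> hF a u v; rewrite scaler_sumr -big_split /=.
by apply: eq_big_seq => i ri; rewrite hF.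
Qed.

Lemma linear_fun_bignat m n (F : nat -> U -> V) :
  (forall i, (m <= i < n)%N -> linear (F i)) ->
  linear (fun u => \sum_(m <= i < n) F i u).
Proof.
by move=> hF; apply: linear_fun_bigsum => i; rewrite mem_index_iota => /hF.
Qed.

End LinearFunctions.

(** * Subspaces and algebraic complements *)

Section Subspaces.
Variables (K : fieldType) (V : lmodType K).
Implicit Types A C W : set V.

Lemma subspaceP A :
  subspace A <-> A 0 /\ forall a u v, A u -> A v -> A (a *: u + v).
Proof.
split=> -[A0 Al]; split; first by have := A0; rewrite inE.
- move=> a u v Au Av.
  by have := Al a u v; rewrite !inE; apply.
- by rewrite inE.
- by move=> a u v; rewrite !inE; apply: Al.
Qed.

Section Closure.
Variables (A : set V) (sA : subspace A).

Lemma subspace0 : A 0. Proof. by have /subspaceP[] := sA. Qed.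

Lemma subspaceZD a u v : A u -> A v -> A (a *: u + v).
Proof. by have /subspaceP[_] := sA; apply. Qed.

Lemma subspaceD u v : A u -> A v -> A (u + v).
Proof. by move=> Au Av; rewrite -[u]scale1r; apply: subspaceZD. Qed.

Lemma subspaceZ a u : A u -> A (a *: u).
Proof. by move=> Au; rewrite -[_ *: _]addr0; apply: subspaceZD subspace0. Qed.

Lemma subspaceN u : A u -> A (- u).
Proof. by rewrite -scaleN1r; apply: subspaceZ. Qed.

Lemma subspaceB u v : A u -> A v -> A (u - v).
Proof. by move=> Au /subspaceN; apply: subspaceD. Qed.

End Closure.

Lemma subspaceT : subspace [set: V].
Proof. by apply/subspaceP. Qed.

Section Complements.
Variables (W A C : set V) (cW : complements W A C).

Lemma complements_subl : A `<=` W.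
Proof.
case: cW => _ sC -> _ a Aa; exists a => //; exists 0; first exact: subspace0.
by rewrite addr0.
Qed.

Lemma complements_subr : C `<=` W.
Proof.
case: cW => sA _ -> _ a Ca; exists 0; first exact: subspace0.
by exists a => //; rewrite add0r.
Qed.

Lemma complements_cap0 u : A u -> C u -> u = 0.
Proof.
case: cW => _ _ _ AC0 Au Cu.
by have : (A `&` C) u by []; rewrite AC0.
Qed.

Lemma complements_split w : W w -> exists a, exists b, [/\ A a, C b & w = a + b].
Proof. by case: cW => _ _ -> _ [a Aa [b Cb <-]]; exists a, b. Qed.

Lemma complements_trivial : A = [set 0] <-> W = C.
Proof.
split=> [A0|WC].
  rewrite eqEsubset; split; last exact: complements_subr.
  by move=> w /complements_split[a [b []]]; rewrite A0 => /= -> Cb ->; rewrite add0r.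
rewrite eqEsubset; split=> [a Aa|_ ->] /=; last by case: cW => /subspace0.
by apply: complements_cap0 => //; rewrite -WC; apply: complements_subl.
Qed.

End Complements.

Lemma complements_sym W A C : complements W A C -> complements W C A.
Proof.
move=> [sA sC WE AC]; split=> //; last by rewrite setIC.
rewrite WE; apply/seteqP; split=> _ [a ? [b ? <-]];
  by exists b => //; exists a => //; rewrite addrC.
Qed.

(* The sets X to which Zorn's lemma is applied need not contain 0, because the
   union of the empty chain is empty. *)
Lemma complement_exists W C :
  subspace W -> subspace C -> C `<=` W -> exists A, complements W A C.
Proof.
move=> sW sC CW.
pose P X := [/\ subspace (X `|` [set 0]), X `<=` W & X `&` C `<=` [set 0]].
have [F FP Ftot|X [[sX XW XC] Xmax]] := @Zorn_bigcup _ P.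
  split.
  - apply/subspaceP; split; first by right.
    have inc X : F X -> X `|` [set 0] `<=` \bigcup_(Y in F) Y `|` [set 0].
      by move=> FX x [Xx|x0]; [left; exists X|right].
    move=> a u v [[X FX Xu]|->] [[Y FY Yv]|->].
    + have [XY|YX] := Ftot _ _ FX FY.
        have [sY _ _] := FP _ FY; apply: (inc _ FY).
        by apply: subspaceZD => //; left=> //; apply: XY.
      have [sX _ _] := FP _ FX; apply: (inc _ FX).
      by apply: subspaceZD => //; left=> //; apply: YX.
    + have [sX _ _] := FP _ FX; apply: (inc _ FX).
      by apply: subspaceZD => //; [left|right].
    + have [sY _ _] := FP _ FY; apply: (inc _ FY).
      by apply: subspaceZD => //; [right|left].
    + by rewrite scaler0 addr0; right.
  - by move=> x [X /FP[_ XW _]]; apply: XW.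
  - by move=> x [[X /FP[_ _ XC] Xx] Cx]; apply: XC.
pose A := X `|` [set 0].
have AW : A `<=` W by move=> x [/XW//|->]; apply: subspace0.
exists A; split=> //.
- rewrite eqEsubset; split=> [w Ww|_ [a Aa [b Cb <-]]]; last first.
    by apply: subspaceD => //; [apply: AW|apply: CW].
  apply: contrapT => nw.
  (* If [a + t *: w] lay in [C] with [t] nonzero, dividing by [t] would split [w], against [nw]. *)
  have nwA t a : A a -> C (a + t *: w) -> t = 0.
    move=> Aa Cat; apply: contrapT => /eqP t0; apply: nw.
    exists (- (t^-1 *: a)); first by apply: subspaceN => //; apply: subspaceZ.
    exists (t^-1 *: (a + t *: w)); first exact: subspaceZ.
    by rewrite scalerDr scalerA mulVf // scale1r addKr.
  (* [A'] is [A] enlarged by the line through [w]. It satisfies [P], by [nwA] for the intersection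
     with [C], and properly contains [X], against maximality. *)
  pose A' := [set x | exists a, exists t, A a /\ x = a + t *: w].
  have A'0 : A' 0 by exists 0, 0; rewrite scale0r addr0; split=> //; right.
  have A'E : A' `|` [set 0] = A'.
    by apply/seteqP; split=> [x [//|->//]|x]; left.
  apply: (Xmax A').
    split=> [x Xx|XA'].
      by exists x, 0; rewrite scale0r addr0; split=> //; left.
    have /XA' Xw : A' w.
      by exists 0, 1; rewrite scale1r add0r; split=> //; right.
    apply: nw; exists w; first by left.
    by exists 0; [exact: subspace0|rewrite addr0].
  split.
  - rewrite A'E; apply/subspaceP; split=> // r _ _ [a [t [Aa ->]]] [b [s [Ab ->]]].
    exists (r *: a + b), (r * t + s); split; first exact: subspaceZD.
    by rewrite scalerDr scalerDl scalerA addrACA.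
  - move=> _ [a [t [Aa ->]]]; apply: subspaceD => //; first exact: AW.
    exact: subspaceZ.
  - move=> _ [[a [t [Aa ->]]] Ca] /=.
    have t0 := nwA _ _ Aa Ca; move: Ca; rewrite t0 scale0r addr0 => Ca.
    by case: Aa => // Xa; apply: XC.
- rewrite eqEsubset; split=> [x [[Xx|//] Cx]|_ ->]; first exact: XC.
  by split; [right|apply: subspace0].
Qed.

End Subspaces.

(** * Components in direct sums, and chains of successive complements *)

Section DirectSumTheory.
Variables (K : fieldType) (V : lmodType K).

Section Components.
Variables (I : finType) (F : I -> set V) (dF : direct_sum setT F).

Let sF i : subspace (F i). Proof. by case: dF. Qed.

(** [component] picks some decomposition by [xget]; uniqueness of decompositions forces it to be
    [x]. *)
Lemma componentE x i : selection F x -> component F i (\sum_j x j) = x i.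
Proof.
move=> Fx; rewrite /component.
case: xgetP => [y _ [Fy Exy]|/(_ x)]; last by case.
have [_ _ inj] := dF.
by congr (fun_of_fin _ i); apply: inj => //; rewrite inE.
Qed.

Lemma direct_sum_split y : exists2 x, selection F x & y = \sum_j x j.
Proof.
have [_ /seteqP[+ _] _] := dF => /(_ y) [] // x Fx <-; by exists x.
Qed.

Lemma component_mem i y : F i (component F i y).
Proof. by have [x Fx ->] := direct_sum_split y; rewrite componentE. Qed.

Lemma component_linear i : linear (component F i).
Proof.
move=> a y z.
have [x Fx ->] := direct_sum_split y; have [x' Fx' ->] := direct_sum_split z.
rewrite !componentE // scaler_sumr -big_split /=.
rewrite (eq_bigr (fun j => (a *: x + x') j)); last by move=> j _; rewrite !ffunE.
rewrite componentE ?ffunE // => j; rewrite !ffunE; exact: subspaceZD.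
Qed.

Lemma component_in i l y : F l y -> component F i y = if l == i then y else 0.
Proof.
move=> Fy; pose x := [ffun j => if l == j then y else 0].
have Fx : selection F x.
  by move=> j; rewrite ffunE; case: eqP => [<-//|_]; apply: subspace0.
have := componentE i Fx; rewrite ffunE => <-; congr component.
rewrite (bigD1 l) //= ffunE eqxx big1 ?addr0 // => j /negbTE.
by rewrite ffunE eq_sym => ->.
Qed.

End Components.

Section Chains.
Variables (A C : nat -> set V).
Hypothesis C0 : C 0%N = setT.

Lemma chain_split n y :
  (forall j, (j < n)%N -> complements (C j) (A j.+1) (C j.+1)) ->
  exists x : nat -> V, exists b,
    [/\ forall i, (i < n)%N -> A i.+1 (x i), C n b
      & y = \sum_(i < n) x i + b].
Proof.
elim: n => [|n IH] h.
  by exists (fun=> 0), y; rewrite C0 big_ord0 add0r.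
have [j ljn|x [b [Ax Cb ->]]] := IH; first by apply: h; apply: ltnW.
have [a [d [Aa Cd ->]]] := complements_split (h _ (leqnn _)) Cb.
exists [eta x with n |-> a], d; split=> //=.
  move=> i; rewrite ltnS leq_eqVlt => /orP[/eqP ->|lin]; first by rewrite eqxx.
  by rewrite ltn_eqF //; apply: Ax.
rewrite big_ord_recr /= eqxx -addrA; congr (_ + _).
by apply: eq_bigr => i _; rewrite ltn_eqF.
Qed.

Lemma chain_subspace n :
  (forall j, (j < n)%N -> complements (C j) (A j.+1) (C j.+1)) -> subspace (C n).
Proof.
case: n => [_|n h]; first by rewrite C0; apply: subspaceT.
by have [] := h _ (leqnn _).
Qed.

(** Peeling from the end: [x n + b] lies in [C n], so by induction it vanishes together with the
    earlier terms, and then [x n] lies in both summands of [C n]. *)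
Lemma chain_uniq n (x : nat -> V) b :
  (forall j, (j < n)%N -> complements (C j) (A j.+1) (C j.+1)) ->
  (forall i, (i < n)%N -> A i.+1 (x i)) -> C n b ->
  \sum_(i < n) x i + b = 0 -> (forall i, (i < n)%N -> x i = 0) /\ b = 0.
Proof.
elim: n b => [|n IH] b h Ax Cb; first by rewrite big_ord0 add0r.
rewrite big_ord_recr /= -addrA => E.
have cn := h _ (leqnn _); have [_ sC _ _] := cn.
have h' j : (j < n)%N -> complements (C j) (A j.+1) (C j.+1).
  by move=> ljn; apply: h; apply: ltnW.
have [||x0 E'] := IH _ h' _ _ E.
- by move=> i lin; apply: Ax; apply: ltnW.
- apply: subspaceD; first exact: chain_subspace.
    by apply: (complements_subl cn); apply: Ax.
  exact: (complements_subr cn).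
have xn : x n = 0.
  apply: (complements_cap0 cn); first exact: Ax.
  by rewrite -[x n](addrK b) E' sub0r; apply: subspaceN.
split; last by move: E'; rewrite xn add0r.
by move=> i; rewrite ltnS leq_eqVlt => /orP[/eqP ->|/x0].
Qed.

(** Serves both spaces: [B] with the pair [Nc], [spN], and [B'] with the pair [spR], [Rc]. *)
Lemma chain_direct_sum n :
  (forall j, (j < n)%N -> complements (C j) (A j.+1) (C j.+1)) ->
  direct_sum setT (chain A C n).
Proof.
move=> h.
have sC := chain_subspace h.
have sF i : subspace (chain A C n i).
  by rewrite /chain; case: ifP => // /h[].
split=> //.
  apply/seteqP; split=> // y _.
  have [x [b [Ax Cb ->]]] := chain_split y h.
  exists [ffun i : 'I_n.+1 => if (i < n)%N then x i else b].
    by move=> i; rewrite ffunE /chain; case: ifP => // /Ax.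
  rewrite big_ord_recr /= ffunE /= ltnn; congr (_ + _).
  by apply: eq_bigr => i _; rewrite ffunE /= ltn_ord.
move=> x y; rewrite !inE => Fx Fy /eqP; rewrite -subr_eq0 => /eqP E.
pose z i := x (inord i) - y (inord i).
have Fz i : chain A C n i (x i - y i) by apply: subspaceB.
have [|||z0 b0] := @chain_uniq n z (x ord_max - y ord_max) h.
- move=> i lin; have := Fz (inord i); rewrite /chain inordK ?lin //.
  exact: ltnW.
- by have := Fz ord_max; rewrite /chain ltnn.
- rewrite -[RHS]E -sumrB big_ord_recr /=; congr (_ + _).
  apply: eq_bigr => i _; rewrite /z; congr (x _ - y _); apply: val_inj;
    by rewrite /= inordK // ltnW // ltnS.
apply/ffunP => i; apply/eqP; rewrite -subr_eq0; apply/eqP.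
have := ltn_ord i; rewrite ltnS leq_eqVlt => /orP[/eqP Ei|/z0].
  by rewrite (_ : i = ord_max) //; apply: val_inj.
by rewrite /z inord_val.
Qed.

End Chains.

End DirectSumTheory.

(** * The equations of the recursion with shifted indices *)

Section ShiftedRecursion.
Variables (K : fieldType) (B B' : lmodType K).
Variables (L : nat -> {linear B -> B'}) (c : choices B B').

Local Notation N := (spN L c).
Local Notation R := (spR L c).
Local Notation P := (projR L c).
Local Notation S := (opS L c).
Local Notation Sb := (opSbar L c).
Local Notation E := (opE L c).
Local Notation M := (opM L c).

(* From here on the indices of the recursion are written i.+1, with i counted
   from 0 as in the block operators. *)
Lemma opSbarS j b : Sb j.+2 b = \sum_(0 <= i < j.+1) L i.+1 (M i.+1 j.+1 b).
Proof. by rewrite opSbarE // big_add1. Qed.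

Lemma opS_sub j b : S j.+1 b = Sb j.+1 b - \sum_(0 <= i < j) P i.+1 (Sb j.+1 b).
Proof. by rewrite opSE // big_add1. Qed.

Lemma opE_lt i j b : (i < j)%N -> E i.+1 j.+1 b =
  - invS L c i.+1 (P i.+1 (\sum_(i.+1 <= nu < j.+1) Sb nu.+1 (E nu.+1 j.+1 b))).
Proof. by move=> lij; rewrite opEE ?ltnS // big_add1. Qed.

Lemma opMS i j b : (i <= j)%N ->
  M i.+2 j.+2 b = \sum_(i <= nu < j.+1) M i.+1 nu.+1 (E nu.+2 j.+2 b).
Proof. by move=> lij; rewrite opME ?ltnS // !big_add1. Qed.

Lemma opM_diag j : M j.+1 j.+1 = id.
Proof.
elim: j => [|j IH]; first by rewrite opM1 // opE_diag.
by apply/funext => b; rewrite opMS // big_nat1 IH opE_diag.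
Qed.

Lemma spN_antimono i j : (i <= j)%N -> N j `<=` N i.
Proof.
elim: j => [|j IH]; first by rewrite leqn0 => /eqP ->.
rewrite leq_eqVlt => /orP[/eqP -> //|/IH h] b.
by rewrite spNE => -[/h].
Qed.

Lemma spN1 : N 1 = [set b | L 0%N b = 0].
Proof.
rewrite spNE spN0; apply/seteqP; split=> b /=.
  by rewrite opS_sub big_geq // subr0 opSbar1 => -[].
by rewrite opS_sub big_geq // subr0 opSbar1.
Qed.

End ShiftedRecursion.

(** * Stage n+1, given admissible complements at the stages 1, ..., n *)

Section Stage.
Variables (K : fieldType) (B B' : lmodType K).
Variables (L : nat -> {linear B -> B'}) (c : choices B B') (n : nat).
Hypothesis adm : admissible L c n.

Local Notation N := (spN L c).
Local Notation R := (spR L c).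
Local Notation P := (projR L c).
Local Notation S := (opS L c).
Local Notation Sb := (opSbar L c).
Local Notation E := (opE L c).
Local Notation M := (opM L c).

Lemma admissible_compN j : (j < n)%N -> complements (N j) (Nc c j.+1) (N j.+1).
Proof. by case: adm => _ _ + /[dup] => h /h[]. Qed.

Lemma admissible_compR j : (j < n)%N -> complements (Rc c j) (R j.+1) (Rc c j.+1).
Proof. by case: adm => _ _ + /[dup] => h /h[]. Qed.

Lemma Rc0 : Rc c 0 = setT. Proof. by case: adm. Qed.

Lemma spN_subspace j : (j <= n)%N -> subspace (N j).
Proof.
move=> ljn; apply: (@chain_subspace _ _ (Nc c)) => // i lij.
exact/admissible_compN/(leq_trans lij).
Qed.

Lemma Rc_subspace j : (j <= n)%N -> subspace (Rc c j).
Proof.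
move=> ljn; apply: (@chain_subspace _ _ R _ Rc0) => i lij.
exact/admissible_compR/(leq_trans lij).
Qed.

Lemma chain_N_direct m : (m <= n)%N -> direct_sum setT (chain (Nc c) N m).
Proof.
move=> lmn; apply: chain_direct_sum => // j ljm.
exact/admissible_compN/(leq_trans ljm).
Qed.

Lemma chain_R_direct m : (m <= n)%N -> direct_sum setT (chain R (Rc c) m).
Proof.
move=> lmn; apply: (chain_direct_sum Rc0) => j ljm.
exact/admissible_compR/(leq_trans ljm).
Qed.

Lemma Rc_antimono i j : (i <= j)%N -> (j <= n)%N -> Rc c j `<=` Rc c i.
Proof.
elim: j => [|j IH]; first by rewrite leqn0 => /eqP -> _.
rewrite leq_eqVlt => /orP[/eqP -> _ //|lij ljn] b.
by move=> /(complements_subr (admissible_compR ljn)); apply: IH => //; apply: ltnW.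
Qed.

Lemma projR_linear i : (i < n)%N -> linear (P i.+1).
Proof. by move=> lin; apply/component_linear/chain_R_direct. Qed.

Lemma projR_mem i y : (i < n)%N -> R i.+1 (P i.+1 y).
Proof.
move=> lin; have := component_mem (chain_R_direct lin) (inord i) y.
by rewrite {1}/chain inordK ?leqnn // leqnSn.
Qed.

(** The space [Rc c m] is contained in [Rc c i.+1], which is the last member of the chain defining
    [projR L c i.+1]. *)
Lemma projR_Rc i m y : (i < m <= n)%N -> Rc c m y -> P i.+1 y = 0.
Proof.
move=> /andP[lim lmn] /(Rc_antimono lim lmn) Cy.
have lin := leq_trans lim lmn.
rewrite /projR /proj_of (component_in (chain_R_direct lin) _ (l := ord_max)).
  by rewrite -val_eqE /= inordK ?gtn_eqF.
by rewrite /chain ltnn.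
Qed.

(** The projection with index [i.+1] comes from the decomposition of stage [i.+1]. For [l <= i] the
    space with index [l.+1] is a member of that decomposition; for [l > i] it is contained in the
    remainder [Rc c i.+1]. *)
Lemma projR_in i l y : (i < n)%N -> (l < n)%N -> R l.+1 y ->
  P i.+1 y = if l == i then y else 0.
Proof.
move=> lin lln Ry; have [lli|lil] := leqP l i; last first.
  rewrite gtn_eqF // (@projR_Rc _ l) ?lil ?(ltnW lln) //.
  exact: (complements_subl (admissible_compR lln)).
rewrite /projR /proj_of (component_in (chain_R_direct lin) _ (l := inord l)).
  by rewrite -val_eqE /= !inordK // ltnW // ltnS.
by rewrite /chain inordK ltnS ?lli // ltnW.
Qed.

(** Although the projections belong to decompositions of different stages, together they extract the
    components of [y] in R_1, ..., R_m, which leaves the part in [Rc c m]. This is why S_(m+1) takes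
    its values there. *)
Lemma Rc_residue m y : (m <= n)%N -> Rc c m (y - \sum_(0 <= i < m) P i.+1 y).
Proof.
move=> lmn.
have [|x [b [Ax Cb Ey]]] := chain_split Rc0 y (A := R) (n := m).
  by move=> j ljm; exact/admissible_compR/(leq_trans ljm).
suff -> : y - \sum_(0 <= i < m) P i.+1 y = b by [].
rewrite {1}Ey big_mkord [X in _ - X](eq_bigr (fun i : 'I_m => x i)).
  by rewrite addrC addKr.
move=> i _; have lin := leq_trans (ltn_ord i) lmn.
have lP := projR_linear lin; rewrite Ey (linear_funD lP) (linear_fun_sum lP).
rewrite (projR_Rc _ Cb) ?ltn_ord // addr0 (bigD1 i) //=.
rewrite (projR_in lin lin) ?eqxx; last exact: Ax.
rewrite big1 ?addr0 // => j nji.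
have ljn := leq_trans (ltn_ord j) lmn.
by rewrite (projR_in lin ljn (Ax _ (ltn_ord j))) val_eqE (negbTE nji).
Qed.

Lemma opS_Rc j b : (j <= n)%N -> Rc c j (S j.+1 b).
Proof. by move=> ljn; rewrite opS_sub; apply: Rc_residue. Qed.

Section Inverse.
Variables (i : nat) (lin : (i < n)%N) (linS : linear (S i.+1)).

(** Inside [spN L c i], the kernel of S_(i+1) is [spN L c i.+1]: it meets the complement trivially,
    and dropping the component in it does not change the image. Linearity is a hypothesis of the
    section because the induction in [stage_linear] relies on these facts. *)
Lemma opS_bij : set_bij (Nc c i.+1) (R i.+1) (S i.+1).
Proof.
have cN := admissible_compN lin; split.
- by move=> a Na; rewrite spRE; exists a => //; apply: (complements_subl cN).
- move=> a b; rewrite !inE => Na Nb Eab; apply/eqP; rewrite -subr_eq0; apply/eqP.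
  have sN : subspace (Nc c i.+1) by case: cN.
  have Nab := subspaceB sN Na Nb.
  apply: (complements_cap0 cN) => //; rewrite spNE; split.
    exact: (complements_subl cN).
  by rewrite (linear_funB linS) Eab subrr.
- rewrite spRE => _ [w Nw <-].
  have [a [b [Na]]] := complements_split cN Nw.
  rewrite spNE => -[_ Sb0] ->; exists a => //.
  by rewrite (linear_funD linS) Sb0 addr0.
Qed.

Lemma invS_mem y : R i.+1 y -> Nc c i.+1 (invS L c i.+1 y).
Proof.
by have [+ _ _] := bijpinv_bij (fun=> 0) opS_bij => /(_ y) h /h.
Qed.

Lemma invSK y : R i.+1 y -> S i.+1 (invS L c i.+1 y) = y.
Proof.
move=> Ry; apply: (pinvK (fun=> 0)); rewrite inE.
by have [_ _ /(_ y Ry)] := opS_bij.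
Qed.

(** The inverse is a set-theoretic partial inverse, meaningful only on R_(i+1), hence the
    composition with the projection. Both sides of the linearity equation lie in [Nc c i.+1] and
    have the same image under S_(i+1), which is injective there. *)
Lemma invS_projR_linear : linear (fun y => invS L c i.+1 (P i.+1 y)).
Proof.
move=> a y z; have [_ inj _] := opS_bij.
have sN : subspace (Nc c i.+1) by case: (admissible_compN lin).
have mem w := invS_mem (projR_mem w lin).
apply: inj; rewrite ?inE //; first exact: subspaceZD.
rewrite linS !invSK; try exact: projR_mem.
exact: projR_linear.
Qed.

End Inverse.

(** Strong induction on the stage, in the order of the recursion: Sbar from the previous column of
    M, then S, then the column of E from the bottom up, then the column of M. Stage [j.+1] involves
    only the complements of the stages up to [j], so [j <= n] suffices. *)
Lemma stage_linear j : (j <= n)%N ->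
  [/\ linear (Sb j.+1), linear (S j.+1) &
      forall i, (i <= j)%N -> linear (E i.+1 j.+1) /\ linear (M i.+1 j.+1)].
Proof.
elim/ltn_ind: j => j IH ljn.
have linSb : linear (Sb j.+1).
  case: j IH ljn => [|j] IH ljn; first by rewrite opSbar1 => a u v; rewrite linearP.
  rewrite (_ : Sb _ = fun b => \sum_(0 <= i < j.+1) L i.+1 (M i.+1 j.+1 b)); last first.
    by apply/funext => b; rewrite opSbarS.
  apply: linear_fun_bignat => i /andP[_ lij].
  apply: linear_fun_comp; first by move=> a u v; rewrite linearP.
  by have [] := IH _ (leqnn _) (ltnW ljn) => _ _ /(_ i lij)[].
have linS : linear (S j.+1).
  rewrite (_ : S _ = fun b => Sb j.+1 b - \sum_(0 <= i < j) P i.+1 (Sb j.+1 b)); last first.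
    by apply/funext => b; rewrite opS_sub.
  apply: linear_fun_sub => //; apply: linear_fun_bignat => i /andP[_ lij].
  by apply: linear_fun_comp => //; apply: projR_linear; apply: leq_trans lij ljn.
have linE i : (i <= j)%N -> linear (E i.+1 j.+1).
  (* Induction on [j - i], since row [i] of a column of E is computed from the rows below it. *)
  have [m] := ubnP (j - i); elim: m i => // m IHm i; rewrite ltnS => ljim.
  rewrite leq_eqVlt => /orP[/eqP ->|lij]; first by rewrite opE_diag.
  rewrite (_ : E _ _ = fun b => - invS L c i.+1 (P i.+1
      (\sum_(i.+1 <= nu < j.+1) Sb nu.+1 (E nu.+1 j.+1 b)))); last first.
    by apply/funext => b; rewrite opE_lt.
  have lin := leq_trans lij ljn.
  have [_ linSi _] := IH i lij (ltnW lin).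
  apply: linear_fun_opp; apply: (linear_fun_comp (invS_projR_linear lin linSi)).
  apply: linear_fun_bignat => nu /andP[linu lnuj]; apply: linear_fun_comp.
    (* For [nu = j] the operator is the Sbar of the current stage, treated above; smaller [nu]
       belong to earlier stages. *)
    move: lnuj; rewrite ltnS leq_eqVlt => /orP[/eqP -> //|lnuj].
    by have [] := IH nu lnuj (ltnW (leq_trans lnuj ljn)).
  apply: IHm => //; apply: leq_trans ljim.
  by apply: ltn_sub2l.
split=> // i lij; split; first exact: linE.
case: i lij => [|i] lij; first by rewrite opM1 //; apply: linE.
case: j lij linE IH ljn {linSb linS} => // j lij linE IH ljn.
rewrite (_ : M _ _ = fun b => \sum_(i <= nu < j.+1) M i.+1 nu.+1 (E nu.+2 j.+2 b)); last first.
  by apply/funext => b; rewrite opMS.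
apply: linear_fun_bignat => nu /andP[linu lnuj]; apply: linear_fun_comp; last exact: linE.
by have [_ _ /(_ i linu)[]] := IH nu lnuj (leq_trans (ltnW lnuj) ljn).
Qed.

Lemma opS_linear j : (j <= n)%N -> linear (S j.+1).
Proof. by case/stage_linear. Qed.

Lemma opSbar_linear j : (j <= n)%N -> linear (Sb j.+1).
Proof. by case/stage_linear. Qed.

Lemma opM_linear i j : (i <= j <= n)%N -> linear (M i.+1 j.+1).
Proof. by move=> /andP[lij /stage_linear[_ _ /(_ i lij)[]]]. Qed.

Lemma spNS_subspace : subspace (N n.+1).
Proof.
have sN := spN_subspace (leqnn n); have lS := opS_linear (leqnn n).
rewrite spNE; apply/subspaceP; split.
  by split; [apply: subspace0|apply: linear_fun0].
move=> a u v [Nu Su] [Nv Sv]; split; first exact: subspaceZD.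
by rewrite lS Su Sv scaler0 addr0.
Qed.

Lemma spRS_subspace : subspace (R n.+1).
Proof.
have sN := spN_subspace (leqnn n); have lS := opS_linear (leqnn n).
rewrite spRE; apply/subspaceP; split.
  by exists 0; [apply: subspace0|apply: linear_fun0].
move=> a _ _ [u Nu <-] [v Nv <-]; exists (a *: u + v); first exact: subspaceZD.
by rewrite lS.
Qed.

Lemma complement_N_exists : exists A, complements (N n) A (N n.+1).
Proof.
apply: complement_exists; [exact: spN_subspace|exact: spNS_subspace|].
exact: spN_antimono.
Qed.

Lemma complement_R_exists : exists A, complements (Rc c n) (R n.+1) A.
Proof.
have [|||A hA] := @complement_exists _ _ (Rc c n) (R n.+1).
- exact: Rc_subspace.
- exact: spRS_subspace.
- by rewrite spRE => _ [b _ <-]; apply: opS_Rc.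
by exists A; apply: complements_sym.
Qed.

End Stage.

(** * The kernel of the block Toeplitz operators *)

Section Kernel.
Variables (K : fieldType) (B B' : lmodType K).
Variables (L : nat -> {linear B -> B'}) (c : choices B B').
Hypothesis adm : forall n, admissible L c n.

Local Notation N := (spN L c).
Local Notation R := (spR L c).
Local Notation P := (projR L c).
Local Notation S := (opS L c).
Local Notation Sb := (opSbar L c).
Local Notation E := (opE L c).
Local Notation M := (opM L c).
Local Notation T i y := (invS L c i.+1 (P i.+1 y)).

Let linP i : linear (P i.+1). Proof. exact: projR_linear (adm i.+1) _ _. Qed.
Let linS i : linear (S i.+1). Proof. exact: opS_linear (adm i) _ _. Qed.
Let linSb i : linear (Sb i.+1). Proof. exact: opSbar_linear (adm i) _ _. Qed.
Let linM i j : (i <= j)%N -> linear (M i.+1 j.+1).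
Proof. by move=> lij; apply: (opM_linear (adm j)); rewrite lij /=. Qed.
Let linT i : linear (fun y => T i y).
Proof. exact: (invS_projR_linear (adm i.+1)). Qed.

Let T_mem i y : N i (T i y).
Proof.
apply: (complements_subl (admissible_compN (adm i.+1) (ltnSn i))).
by apply: (invS_mem (adm i.+1)) => //; apply: (projR_mem (adm i.+1)).
Qed.

Let S_T i y : S i.+1 (T i y) = P i.+1 y.
Proof. by apply: (invSK (adm i.+1)) => //; apply: (projR_mem (adm i.+1)). Qed.

Let sN i : subspace (N i). Proof. exact: (spN_subspace (adm i)). Qed.

Lemma opSbar_split j b : Sb j.+1 b = S j.+1 b + \sum_(0 <= i < j) P i.+1 (Sb j.+1 b).
Proof. by rewrite opS_sub subrK. Qed.

(** For [b] in N_nu, Sbar_(nu+1) b is S_(nu+1) b, which lies in R_(nu+1), plus terms in R_1, ...,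
    R_nu. As [nu <= i], only the first can have a component in R_(i+1). *)
Lemma projR_opSbar i nu b : (nu <= i)%N -> N nu b ->
  P i.+1 (Sb nu.+1 b) = if nu == i then S nu.+1 b else 0.
Proof.
move=> lni Nb; rewrite opSbar_split (linear_funD (linP i)).
rewrite (projR_in (adm i.+1) (ltnSn i) (l := nu)) //; last first.
  by rewrite spRE; exists b.
rewrite (linear_fun_sum (linP i)) big1_seq ?addr0 // => l /=.
rewrite mem_index_iota /= => lln; have lli := leq_trans lln lni.
rewrite (projR_in (adm i.+1) (ltnSn i) (l := l)) ?ltn_eqF //; first exact: ltnW.
exact: (projR_mem (adm l.+1)).
Qed.

(** The components beyond [nu] vanish and the one at [nu] is S_(nu+1) b, so nothing is left over in
    the remainder [Rc c k]. *)
Lemma opSbar_sum_projR k nu b : (nu < k)%N -> N nu b ->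
  Sb nu.+1 b = \sum_(0 <= l < k) P l.+1 (Sb nu.+1 b).
Proof.
move=> lnk Nb; rewrite (@big_cat_nat _ _ _ nu.+1) //=.
rewrite [X in _ + X]big1_seq ?addr0; last first.
  move=> l /=; rewrite mem_index_iota => /andP[lnl _].
  by rewrite projR_opSbar ?ltn_eqF // ltnW.
by rewrite big_nat_recr //= projR_opSbar // eqxx addrC -opSbar_split.
Qed.

(** The sum lies in R_1 + ... + R_k, so it vanishes iff all its components do. In the component with
    index [i.+1] the terms [nu < i] drop out and the term [nu = i] contributes S_(i+1) m_i. *)
Lemma sum_opSbar_eq0 k (m : nat -> B) : (forall i, (i < k)%N -> N i (m i)) ->
  \sum_(0 <= nu < k) Sb nu.+1 (m nu) = 0 <->
  forall i, (i < k)%N ->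
    S i.+1 (m i) = - P i.+1 (\sum_(i.+1 <= nu < k) Sb nu.+1 (m nu)).
Proof.
move=> Nm; set y := \sum_(0 <= nu < k) _.
have Py i : (i < k)%N -> P i.+1 y =
    S i.+1 (m i) + P i.+1 (\sum_(i.+1 <= nu < k) Sb nu.+1 (m nu)).
  move=> lik; rewrite /y (@big_cat_nat _ _ _ i) ?(ltnW lik) //=.
  rewrite (@big_ltn _ _ _ i) // !(linear_funD (linP i)) projR_opSbar //; last exact: Nm.
  rewrite eqxx (linear_fun_sum (linP i)) big1_seq ?add0r // => nu /=.
  rewrite mem_index_iota /= => lnui; rewrite projR_opSbar ?ltn_eqF //.
    exact: ltnW.
  by apply: Nm; apply: ltn_trans lik.
have yE : y = \sum_(0 <= l < k) P l.+1 y.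
  under eq_bigr do rewrite /y (linear_fun_sum (linP _)).
  rewrite exchange_big_nat /=; apply: eq_big_nat => nu /andP[_ lnuk].
  by rewrite -opSbar_sum_projR //; apply: Nm.
split=> [y0 i lik|h].
  apply/eqP; rewrite -addr_eq0 -Py // y0; apply/eqP.
  exact: (linear_fun0 (linP i)).
rewrite yE big1_seq // => i /=; rewrite mem_index_iota /= => lik.
by rewrite Py // h // addNr.
Qed.

(** Summing the defining equation of E over the columns: the vector E n is obtained from n by back
    substitution. *)
Lemma sum_opE_rec k (n : nat -> B) i : (i < k)%N ->
  \sum_(i <= j < k) E i.+1 j.+1 (n j) =
  n i - T i (\sum_(i.+1 <= nu < k) Sb nu.+1 (\sum_(nu <= j < k) E nu.+1 j.+1 (n j))).
Proof.
move=> lik; rewrite big_ltn // opE_diag //; congr (_ + _).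
under [in RHS]eq_bigr do rewrite (linear_fun_sum (linSb _)).
rewrite big_nat_triangle (linear_fun_sum (linT i)) -sumrN.
by apply: eq_big_nat => j /andP[lij _]; rewrite opE_lt.
Qed.

(* The n of the right-hand side is n_i = m_i + S_i^-1 P_i sum_(nu > i) Sbar_nu m_nu. *)
Lemma kernel_opE k (m : nat -> B) :
  ((forall i, (i < k)%N -> N i (m i)) /\ \sum_(0 <= nu < k) Sb nu.+1 (m nu) = 0) <->
  exists2 n : nat -> B, forall j, (j < k)%N -> N j.+1 (n j)
    & forall i, (i < k)%N -> m i = \sum_(i <= j < k) E i.+1 j.+1 (n j).
Proof.
split=> [[Nm /(sum_opSbar_eq0 Nm) Sm]|[n Nn mE]].
  pose n i := m i + T i (\sum_(i.+1 <= nu < k) Sb nu.+1 (m nu)).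
  exists n.
    move=> j ljk; rewrite spNE; split.
      by apply: subspaceD => //; apply: Nm.
    by rewrite (linear_funD (linS j)) S_T Sm // addNr.
  (* Downward induction on [i]: [m] and E n satisfy the same back substitution. *)
  move=> i; have [d] := ubnP (k - i); elim: d i => // d IH i; rewrite ltnS => lkid lik.
  rewrite sum_opE_rec //.
  rewrite -(eq_big_nat _ _ (F1 := fun nu => Sb nu.+1 (m nu))) ?addrK //.
  move=> nu /andP[linu lnuk]; rewrite -IH //.
  by apply: leq_trans lkid; apply: ltn_sub2l.
have mrec i : (i < k)%N ->
    m i = n i - T i (\sum_(i.+1 <= nu < k) Sb nu.+1 (m nu)).
  move=> lik; rewrite mE // sum_opE_rec //; congr (_ - T i _).
  by apply: eq_big_nat => nu /andP[_ lnuk]; rewrite mE.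
have Nm i : (i < k)%N -> N i (m i).
  move=> lik; rewrite mrec //; apply: subspaceB => //.
  by apply: (spN_antimono (leqnSn i)); apply: Nn.
(* Applying S_(i+1) to [mrec] removes n_i, which lies in N_(i+1), and turns the correction into the
   required component. *)
split=> //; apply/(sum_opSbar_eq0 Nm) => i lik.
rewrite {1}mrec // (linear_funB (linS i)) S_T.
by have := Nn i lik; rewrite spNE => -[_ ->]; rewrite sub0r.
Qed.

(** After exchanging the sums, the coefficient of m_(j+1) is the sum of the L_(i+1) M_(i+1,j+1) over
    [i <= j], which is Sbar_(j+2) by definition. *)
Lemma sum_L_opM k (u m : nat -> B) : u 0%N = m 0%N ->
  (forall i, (i < k)%N -> u i.+1 = \sum_(i <= j < k) M i.+1 j.+1 (m j.+1)) ->
  \sum_(0 <= j < k.+1) L j (u j) = \sum_(0 <= nu < k.+1) Sb nu.+1 (m nu).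
Proof.
move=> u0 uS; rewrite !big_nat_recl //= u0 opSbar1; congr (_ + _).
under [in RHS]eq_bigr do rewrite opSbarS.
rewrite -big_nat_triangle; apply: eq_big_nat => i /andP[_ lik].
by rewrite uS // linear_sum.
Qed.

(** The rows after the first in the factorization of M^(k+1) as 1 + M^(k) composed with E. *)
Lemma sum_opM_opE k (m n : nat -> B) i :
  (forall i, (i < k.+1)%N -> m i = \sum_(i <= j < k.+1) E i.+1 j.+1 (n j)) ->
  \sum_(i <= nu < k) M i.+1 nu.+1 (m nu.+1) =
  \sum_(i.+1 <= j < k.+1) M i.+2 j.+1 (n j).
Proof.
move=> mE; rewrite [RHS]big_add1 /=.
transitivity (\sum_(i <= nu < k) \sum_(nu <= j < k) M i.+1 nu.+1 (E nu.+2 j.+2 (n j.+1))).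
  apply: eq_big_nat => nu /andP[linu lnuk].
  by rewrite mE // big_add1 (linear_fun_sum (linM linu)).
rewrite big_nat_triangle; apply: eq_big_nat => j /andP[lij _].
by rewrite opMS.
Qed.

(** Vectors are sequences over [nat] here, so that passing to the tail is a shift; by the Toeplitz
    structure the rows after the first are the system of size [k] for the tail. *)
Lemma kernel_opM k (u : nat -> B) :
  (forall i, (i < k)%N -> \sum_(i <= j < k) L (j - i)%N (u j) = 0) <->
  exists2 n : nat -> B, forall j, (j < k)%N -> N j.+1 (n j)
    & forall i, (i < k)%N -> u i = \sum_(i <= j < k) M i.+1 j.+1 (n j).
Proof.
elim: k u => [|k IH] u; first by split=> // _; exists (fun=> 0).
have shift i : \sum_(i.+1 <= j < k.+1) L (j - i.+1)%N (u j) =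
    \sum_(i <= j < k) L (j - i)%N (u j.+1).
  by rewrite big_add1; apply: eq_bigr => j _; rewrite subSS.
have head : \sum_(0 <= j < k.+1) L (j - 0)%N (u j) = \sum_(0 <= j < k.+1) L j (u j).
  by apply: eq_bigr => j _; rewrite subn0.
split=> [ker|[n Nn uE]].
  have [n Nn uE] : exists2 n : nat -> B, forall j, (j < k)%N -> N j.+1 (n j)
      & forall i, (i < k)%N -> u i.+1 = \sum_(i <= j < k) M i.+1 j.+1 (n j).
    by apply/(IH (fun j => u j.+1)) => i lik; rewrite -shift; apply: ker.
  (* The entry at 0 is unconstrained because N_0 is the whole space. *)
  pose m i := if i is i'.+1 then n i' else u 0%N.
  have [n' Nn' mE] : exists2 n' : nat -> B, forall j, (j < k.+1)%N -> N j.+1 (n' j)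
      & forall i, (i < k.+1)%N -> m i = \sum_(i <= j < k.+1) E i.+1 j.+1 (n' j).
    apply/kernel_opE; split; first by case.
    by rewrite -(sum_L_opM (u := u)) // -head; apply: ker.
  exists n' => // -[_|i lik].
    by rewrite -[u 0%N]/(m 0%N) mE //; apply: eq_bigr => j _; rewrite opM1.
  by rewrite -(sum_opM_opE _ mE) uE.
(* For the converse, the entries of E n after the first lie in N_(j+1), exactly what the induction
   hypothesis requires of the tail. *)
pose m i := \sum_(i <= j < k.+1) E i.+1 j.+1 (n j).
have [Nm Sm] : (forall i, (i < k.+1)%N -> N i (m i)) /\
    \sum_(0 <= nu < k.+1) Sb nu.+1 (m nu) = 0.
  by apply/kernel_opE; exists n.
have u0 : u 0%N = m 0%N by rewrite uE //; apply: eq_bigr => j _; rewrite opM1.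
have uS i : (i < k)%N -> u i.+1 = \sum_(i <= j < k) M i.+1 j.+1 (m j.+1).
  by move=> lik; rewrite uE // (@sum_opM_opE _ m n).
case=> [_|i lik]; first by rewrite head (sum_L_opM u0 uS).
rewrite shift; move: i lik; apply/(IH (fun j => u j.+1)).
by exists (fun j => m j.+1) => // j ljk; apply: Nm.
Qed.

Lemma opM_triangular_inj k (n : nat -> B) :
  (forall i, (i < k)%N -> \sum_(i <= j < k) M i.+1 j.+1 (n j) = 0) ->
  forall i, (i < k)%N -> n i = 0.
Proof.
move=> h i; have [d] := ubnP (k - i); elim: d i => // d IH i; rewrite ltnS => lkid lik.
have := h i lik; rewrite big_ltn // opM_diag big1_seq ?addr0 // => j /=.
rewrite mem_index_iota => /andP[lij ljk]; rewrite IH //.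
  by apply: linear_fun0; apply: linM; apply: ltnW.
by apply: leq_trans lkid; apply: ltn_sub2l.
Qed.

(** Here [u] is any extension of [v] to [nat]; this links finite functions to the sequences of
    [kernel_opM]. *)
Lemma DeltaE k (v : {ffun 'I_k -> B}) (u : nat -> B) (i : 'I_k) :
  (forall j : 'I_k, v j = u j) ->
  Delta L v i = \sum_(i <= j < k) L (j - i)%N (u j).
Proof.
move=> vu; rewrite ffunE -big_ord_upper; apply: eq_bigr => j _.
by rewrite vu; case: ifP.
Qed.

Lemma MmxE k (v : {ffun 'I_k.+1 -> B}) (u : nat -> B) (i : 'I_k.+1) :
  (forall j : 'I_k.+1, v j = u j) ->
  Mmx L c v i = \sum_(i <= j < k.+1) M i.+1 j.+1 (u j).
Proof.
move=> vu; rewrite ffunE -big_ord_upper; apply: eq_bigr => j _.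
by rewrite vu; case: ifP.
Qed.

Lemma Delta_eq0 k (v : {ffun 'I_k -> B}) (u : nat -> B) :
  (forall j : 'I_k, v j = u j) ->
  Delta L v = 0 <->
  forall i, (i < k)%N -> \sum_(i <= j < k) L (j - i)%N (u j) = 0.
Proof.
move=> vu; split=> [Dv i lik|h].
  have /ffunP/(_ (Ordinal lik)) := Dv.
  by rewrite (DeltaE _ vu) ffunE.
by apply/ffunP => i; rewrite (DeltaE _ vu) ffunE h.
Qed.

Lemma Delta_kernel k : [set v | Delta L (k := k.+1) v = 0] =
  Mmx L c (k := k) @` selection (fun j : 'I_k.+1 => N j.+1).
Proof.
have inordE (v : {ffun 'I_k.+1 -> B}) (j : 'I_k.+1) : v j = v (inord j).
  by rewrite inord_val.
apply/seteqP; split=> [v /=|_ [w Nw <-]] /=.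
  move=> /(@Delta_eq0 _ _ (fun j => v (inord j)) (inordE v)) /kernel_opM[n Nn vE].
  exists [ffun j : 'I_k.+1 => n j]; first by move=> j; rewrite ffunE; apply: Nn.
  apply/ffunP => i; rewrite (@MmxE _ _ n) => [|j]; last by rewrite ffunE.
  by rewrite -vE // inord_val.
pose u i := \sum_(i <= j < k.+1) M i.+1 j.+1 (w (inord j)).
apply/(@Delta_eq0 _ _ u) => [j|].
  by rewrite (@MmxE _ _ (fun j => w (inord j)) _ (inordE w)).
apply/kernel_opM; exists (fun j => w (inord j)) => // j ljk.
by have := Nw (inord j); rewrite inordK.
Qed.

Lemma Mcol_sum k (v : {ffun 'I_k.+1 -> B}) : \sum_j Mcol L c j (v j) = Mmx L c v.
Proof.
apply/ffunP => i; rewrite sum_ffunE ffunE; apply: eq_bigr => j _.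
rewrite ffunE (leq_eqVlt i) val_eqE; case: (eqVneq i j) => [->|]; last by case: ltnP.
by rewrite ltnn /= opM_diag.
Qed.

Lemma Mcol_linear k (j : 'I_k.+1) : linear (Mcol L c j).
Proof.
move=> a u v; apply/ffunP => i; rewrite !ffunE.
case: ltnP => [lij|_]; first by rewrite linM // ltnW.
by case: ifP => // _; rewrite scaler0 addr0.
Qed.

Lemma Mmx_linear k : linear (Mmx L c (k := k)).
Proof.
move=> a u v; rewrite -!Mcol_sum scaler_sumr -big_split /=.
by apply: eq_bigr => j _; rewrite !ffunE Mcol_linear.
Qed.

Lemma Mmx_inj k : injective (Mmx L c (k := k)).
Proof.
move=> u v /eqP; rewrite -subr_eq0 -(linear_funB (@Mmx_linear k)) => /eqP /ffunP E0.
apply/eqP; rewrite -subr_eq0; apply/eqP/ffunP => i.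
pose w i := (u - v) (inord i).
have wE (j : 'I_k.+1) : (u - v) j = w j by rewrite /w inord_val.
rewrite wE [RHS]ffunE; apply: (@opM_triangular_inj k.+1) => // l llk.
by have := E0 (Ordinal llk); rewrite (MmxE _ wE) ffunE.
Qed.

(** The description of the kernel read column by column; uniqueness is injectivity of M^(k+1),
    applied to the preimages selected by [pick]. *)
Lemma Mcol_direct_sum k : direct_sum [set v | Delta L (k := k.+1) v = 0]
  (fun j : 'I_k.+1 => Mcol L c j @` N j.+1).
Proof.
have pick (x : {ffun 'I_k.+1 -> {ffun 'I_k.+1 -> B}}) :
    selection (fun j : 'I_k.+1 => Mcol L c j @` N j.+1) x ->
    exists v, [/\ selection (fun j : 'I_k.+1 => N j.+1) v,
      forall j, x j = Mcol L c j (v j) & \sum_j x j = Mmx L c v].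
  move=> Fx.
  have [f fP] := choice (fun j => let: ex_intro2 n Nn E := Fx j in ex_intro _ n (conj Nn E)).
  exists (finfun f); split.
  - by move=> j; rewrite ffunE; case: (fP j).
  - by move=> j; rewrite ffunE; case: (fP j).
  - rewrite -Mcol_sum; apply: eq_bigr => j _; rewrite ffunE.
    by case: (fP j).
split.
- move=> j; apply/subspaceP; split.
    by exists 0; [apply: subspace0|apply: (linear_fun0 (Mcol_linear _))].
  move=> a _ _ [u Nu <-] [v Nv <-]; exists (a *: u + v); first exact: subspaceZD.
  by rewrite Mcol_linear.
- rewrite Delta_kernel; apply/seteqP; split=> [_ [w Nw <-]|_ [x /pick[v [Nv _ ->]] <-]].
    exists [ffun j => Mcol L c j (w j)].
      by move=> j; rewrite ffunE; exists (w j) => //; apply: Nw.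
    by rewrite -Mcol_sum; apply: eq_bigr => j _; rewrite ffunE.
  by exists v.
- move=> x y; rewrite !inE => /pick[u [_ xE ->]] /pick[v [_ yE ->]] /Mmx_inj uv.
  by apply/ffunP => j; rewrite xE yE uv.
Qed.

(** The last row of M^(k+1) is (0, ..., 0, I), and b_0 is stored as the last entry. Conversely [b0]
    is reached from the vector whose only nonzero entry is [b0] in the last place. *)
Lemma spN_kernel k b0 :
  (exists2 b : {ffun 'I_k.+1 -> B}, b ord_max = b0 & Delta L b = 0) <-> N k.+1 b0.
Proof.
have last_Mmx (w : {ffun 'I_k.+1 -> B}) : Mmx L c w ord_max = w ord_max.
  rewrite (@MmxE _ _ (fun j => w (inord j))) => [|j]; last by rewrite inord_val.
  rewrite big_nat1 opM_diag; congr (w _); apply: val_inj.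
  by rewrite /= inordK.
split=> [[b <- Db]|Nb].
  have : [set v | Delta L (k := k.+1) v = 0] b by [].
  by rewrite Delta_kernel => -[w Nw <-]; rewrite last_Mmx; have := Nw ord_max.
pose w := [ffun j : 'I_k.+1 => if j == ord_max then b0 else 0].
have Nw : selection (fun j : 'I_k.+1 => N j.+1) w.
  by move=> j; rewrite ffunE; case: eqP => [->//|_]; apply: subspace0.
exists (Mmx L c w); first by rewrite last_Mmx ffunE eqxx.
suff : [set v | Delta L (k := k.+1) v = 0] (Mmx L c w) by [].
by rewrite Delta_kernel; exists w.
Qed.

End Kernel.

(** * Rank and stabilization in terms of the subspaces N_k *)

Section Rank.
Variables (F : realType) (K : fieldType) (B B' : lmodType K).
Variables (L : nat -> {linear B -> B'}) (c : choices B B').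
Hypothesis adm : forall n, admissible L c n.

Local Notation N := (spN L c).
Local Notation R := (spR L c).
Local Notation rk := (rank F L).

Lemma spN_le_rank k b0 : N k b0 -> ((k%:R)%:E <= rk b0)%E.
Proof.
have ub j : N j.+1 b0 -> ((j.+1%:R)%:E <= rk b0)%E.
  move=> Nb; rewrite /rank.
  have := spN_antimono (isT : (1 <= j.+1)%N) Nb; rewrite spN1 => /= ->.
  by rewrite eqxx; apply: ereal_sup_ubound; exists j => //; apply/(spN_kernel adm).
case: k => [_|k]; last exact: ub.
(* For [k = 0] nonnegativity is needed: if L_0 b_0 = 0 the supremum is at least its member 1,
   otherwise the rank is 0 by definition. *)
have [L0|L0] := eqVneq (L 0%N b0) 0; last by rewrite /rank (negbTE L0).
apply: le_trans (ub 0%N _); first by rewrite lee_fin ler_nat.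
by rewrite spN1.
Qed.

Lemma rank_le_spN k b0 : ~ N k.+1 b0 -> (rk b0 <= (k%:R)%:E)%E.
Proof.
move=> nN; rewrite /rank; case: ifP => _; last by rewrite lee_fin ler0n.
apply: ge_ereal_sup => _ [j /= /(spN_kernel adm) Nb <-].
rewrite lee_fin ler_nat ltnNge; apply/negP => lkj.
by apply: nN; apply: spN_antimono Nb.
Qed.

Lemma le_rank k b0 : ((k%:R)%:E <= rk b0)%E <-> N k b0.
Proof.
split; last exact: spN_le_rank.
case: k => [//|k] h; apply: contrapT => /rank_le_spN /(le_trans h).
by rewrite lee_fin ler_nat ltnn.
Qed.

Lemma rank_eq k b0 : rk b0 = (k%:R)%:E <-> (N k `\` N k.+1) b0.
Proof.
split=> [E|[Nk nNk]].
  split; first by apply/le_rank; rewrite E.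
  by move=> /le_rank; rewrite E lee_fin ler_nat ltnn.
by apply/eqP; rewrite eq_le rank_le_spN ?spN_le_rank.
Qed.

Lemma rank_pinfty b0 : (forall k, N k b0) -> rk b0 = +oo%E.
Proof.
move=> h; apply: eq_infty => r; apply: le_trans (spN_le_rank (h (Num.trunc r).+1)).
by rewrite lee_fin; apply: ltW; apply: truncnS_gt.
Qed.

Lemma Nc_rank k b0 : Nc c k.+1 b0 -> b0 <> 0 -> rk b0 = (k%:R)%:E.
Proof.
have cN := admissible_compN (adm k.+1) (ltnSn k).
move=> Nb b00; apply/rank_eq; split; first exact: (complements_subl cN).
by move=> Nb'; apply: b00; apply: (complements_cap0 cN).
Qed.

(** Every [b] starts in N_0, so it leaves the decreasing sequence at some first step; that step is
    its finite rank. *)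
Lemma spN_exit k b : ~ N k.+1 b -> exists2 m, (m <= k)%N & (N m `\` N m.+1) b.
Proof.
elim: k => [|k IH] nN; first by exists 0%N.
have [Nb|/IH[m lmk ?]] := pselect (N k.+1 b); first by exists k.+1.
by exists m => //; apply: leqW.
Qed.

Lemma stabilizes_spN k : stabilizes_at F L k <->
  (N k.+1 `<` N k /\ forall l, (2 <= l)%N -> N k.+1 = N (k + l)%N).
Proof.
split=> [[h [b0 /rank_eq[Nb nNb]]]|[[_ nN] st]].
  split; first by split; [exact: spN_antimono|move=> /(_ _ Nb)].
  move=> l l2; apply/seteqP; split; last first.
    by apply: spN_antimono; rewrite -addn1 leq_add2l ltnW.
  (* An element of N_(k+1) cannot have a rank [m <= k], so its rank is infinite and it lies in every
     N_j. *)
  move=> b Nb1; apply/le_rank; have [[m lmk /rank_eq[_ []]]|->] := h b.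
    exact: spN_antimono Nb1.
  by rewrite leey.
split; last first.
  have [b Nb nNb] : exists2 b, N k b & ~ N k.+1 b.
    apply: contrapT => h; apply: nN => b Nb; apply: contrapT => nNb.
    by apply: h; exists b.
  by exists b; apply/rank_eq.
move=> b; have [Nb|/spN_exit[m lmk /rank_eq E]] := pselect (N k.+1 b); last first.
  by left; exists m.
right; apply: rank_pinfty => j; have [ljk|lkj] := leqP j k.+1.
  exact: spN_antimono Nb.
have lkj' : (k <= j)%N by apply: ltnW; apply: ltnW.
by rewrite -(subnKC lkj') -st // ltn_subRL addn1.
Qed.

(** Common form of the first two criteria: [Q j] stands for the triviality of N_j^c or of R_j, and
    each means that stage [j] does not shrink N. *)
Lemma stabilizes_step k (Q : nat -> Prop) : (forall j, Q j.+1 <-> N j = N j.+1) ->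
  stabilizes_at F L k <-> (~ Q k.+1 /\ forall l, (2 <= l)%N -> Q (k + l)%N).
Proof.
move=> QE; apply: iff_trans (stabilizes_spN k) _; split=> -[h st].
  split; first by rewrite QE => E; move: h => [_]; rewrite E; apply.
  case=> [|[|l]] // _; rewrite addnS QE.
  (* The equality of N_(k+1) and N_(k+2) is treated apart, since [st] only speaks of offsets at
     least 2. *)
  case: l => [|l]; first by rewrite addn1 (st 2%N) // addn2.
  by rewrite -addnS -!st.
split.
  rewrite properEneq; split; last exact: spN_antimono.
  by apply/eqP => E; apply: h; rewrite QE.
case=> [|[|l]] // _; elim: l => [|l IH].
  by rewrite addn2; apply/QE; rewrite -addn2; apply: st.
by rewrite IH [in RHS]addnS; apply/QE; rewrite -addnS; apply: st.
Qed.

Lemma Nc_trivial j : Nc c j.+1 = [set 0] <-> N j = N j.+1.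
Proof. exact: complements_trivial (admissible_compN (adm j.+1) (ltnSn j)). Qed.

(** R_(j+1) is the image of N_j under S_(j+1), whose kernel in N_j is N_(j+1). *)
Lemma spR_trivial j : R j.+1 = [set 0] <-> N j = N j.+1.
Proof.
rewrite spRE; split=> [R0|NE].
  apply/seteqP; split; last exact: spN_antimono.
  move=> b Nb; rewrite spNE; split=> //.
  suff : [set 0] (opS L c j.+1 b) by [].
  by rewrite -R0; exists b.
apply/seteqP; split=> [_ [b + <-]|_ ->] /=; first by rewrite NE spNE => -[].
exists 0; first exact: subspace0 (spN_subspace (adm j) (leqnn j)).
exact: linear_fun0 (opS_linear (adm j) (leqnn j)).
Qed.

End Rank.

(** * Extending finitely many choices of complements to all stages *)

Section Extension.
Variables (K : fieldType) (B B' : lmodType K).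
Variables (L : nat -> {linear B -> B'}).

Definition agree (n : nat) (c c' : choices B B') : Prop :=
  forall i, (i <= n)%N -> Nc c' i = Nc c i /\ Rc c' i = Rc c i.

Lemma agree_trans m n c1 c2 c3 : (m <= n)%N ->
  agree m c1 c2 -> agree n c2 c3 -> agree m c1 c3.
Proof.
move=> lmn h12 h23 i lim.
by have [<- <-] := h12 i lim; apply: h23; apply: leq_trans lmn.
Qed.

Lemma proj_of_agree n c c' tR i : agree n c c' -> (i <= n)%N ->
  proj_of c' tR i = proj_of c tR i.
Proof.
move=> h lin; rewrite /proj_of; congr (component _ _).
by apply/funext => l; rewrite /chain; have [_ ->] := h i lin.
Qed.

Lemma inv_of_agree n c c' tS i : agree n c c' -> (i <= n)%N ->
  inv_of c' tS i = inv_of c tS i.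
Proof. by move=> h lin; rewrite /inv_of; have [-> _] := h i lin. Qed.

Lemma colE_agree n c c' tSbar tS tR d : agree n c c' ->
  colE c' tSbar tS tR n.+1 d = colE c tSbar tS tR n.+1 d.
Proof.
move=> h; elim: d => // d IH.
have ld : (n.+1 - d.+1 <= n)%N by rewrite subSS leq_subr.
rewrite /= IH (proj_of_agree _ h ld) (inv_of_agree _ h ld) //.
Qed.

Lemma next_stage_agree n c c' h : agree n c c' ->
  next_stage L c' n.+1 h = next_stage L c n.+1 h.
Proof.
move=> cc'; pose Sbar b :=
  if n.+1 == 1%N then L 0%N b else \sum_(1 <= i < n.+1) L i (tabM h n i b).
have ES : (fun b => Sbar b - \sum_(1 <= i < n.+1) proj_of c' (tabR h) i (Sbar b)) =
    (fun b => Sbar b - \sum_(1 <= i < n.+1) proj_of c (tabR h) i (Sbar b)).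
  apply/funext => b; congr (_ - _); apply: eq_big_nat => i /andP[_ lin].
  by rewrite (proj_of_agree _ cc').
(* [body] isolates the only two places where the choices enter the stage, the column of E and the
   operator S. *)
pose body col S_j :=
  let tSbar := [eta tabSbar h with n.+1 |-> Sbar] in
  let tS := [eta tabS h with n.+1 |-> S_j] in
  let tR := [eta tabR h with n.+1 |-> S_j @` tabN h n] in
  let E_j := col tSbar tS tR in
  let M_j i b :=
    if i == 1%N then E_j 1%N b
    else \sum_(i <= nu < n.+2) tabM h nu.-1 i.-1 (E_j nu b) in
  Tables tSbar tS
    [eta tabN h with n.+1 |-> [set m | tabN h n m /\ S_j m = 0]] tR
    [eta tabE h with n.+1 |-> E_j] [eta tabM h with n.+1 |-> M_j].
have nextE d : next_stage L d n.+1 h = body (fun tSbar tS tR => colE d tSbar tS tR n.+1 n)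
  (fun b => Sbar b - \sum_(1 <= i < n.+1) proj_of d (tabR h) i (Sbar b)) by [].
rewrite !nextE ES; congr body.
by apply/funext => tSbar; apply/funext => tS; apply/funext => tR; apply: colE_agree.
Qed.

(** Stage [n.+1] uses complements only up to index [n], so those of index [n.+1] can be chosen after
    its N and R are known. *)
Lemma run_agree n c c' : agree n c c' -> run L c' n.+1 = run L c n.+1.
Proof.
elim: n => [|n IH] h; first exact: next_stage_agree.
have h' : agree n c c' by move=> i lin; apply: h; apply: leqW.
rewrite -[LHS]/(next_stage L c' n.+2 (run L c' n.+1)).
by rewrite IH // (next_stage_agree _ h).
Qed.

Lemma spN_agree n c c' i : agree n c c' -> (i <= n.+1)%N -> spN L c' i = spN L c i.
Proof.
case: i => // i h lin; rewrite /spN (@run_agree i c c') // => l lli.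
exact/h/(leq_trans lli).
Qed.

Lemma spR_agree n c c' i : agree n c c' -> (i <= n.+1)%N -> spR L c' i = spR L c i.
Proof.
case: i => // i h lin; rewrite /spR (@run_agree i c c') // => l lli.
exact/h/(leq_trans lli).
Qed.

Lemma admissible_agree n c c' : agree n c c' -> admissible L c n -> admissible L c' n.
Proof.
move=> h [N0 R0 comp]; have [N0' R0'] := h 0%N isT.
split; rewrite ?N0' ?R0' // => j ljn.
rewrite !(spN_agree h) ?(spR_agree h) //; try by rewrite ?leqW // ltnW.
have [-> ->] := h j.+1 ljn; have [_ ->] := h j (ltnW ljn).
exact: comp.
Qed.

Lemma admissible_leq m n c : (m <= n)%N -> admissible L c n -> admissible L c m.
Proof.
by move=> lmn [? ? h]; split=> // j ljm; apply: h; apply: leq_trans lmn.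
Qed.

Lemma admissible_extend1 n c : admissible L c n ->
  exists2 c', agree n c c' & admissible L c' n.+1.
Proof.
move=> adm; have [A hA] := complement_N_exists adm.
have [D hD] := complement_R_exists adm.
pose c' := Choices [eta Nc c with n.+1 |-> A] [eta Rc c with n.+1 |-> D].
have cc' : agree n c c' by move=> i lin; rewrite /= ltn_eqF.
exists c' => //; have [N0 R0 comp] := admissible_agree cc' adm.
split=> // j; rewrite ltnS leq_eqVlt => /orP[/eqP ->|]; last exact: comp.
rewrite !(spN_agree cc') ?(spR_agree cc') ?leqnSn //=.
by rewrite eqxx ltn_eqF.
Qed.

Lemma admissible_extend k c : admissible L c k ->
  exists c', agree k c c' /\ forall n, admissible L c' n.
Proof.
move=> adm.
(* The extension step is made total, returning its argument when that is not admissible, so that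
   [choice] applies. *)
have step (p : nat * choices B B') : exists c', admissible L p.2 p.1 ->
    agree p.1 p.2 c' /\ admissible L c' p.1.+1.
  have [/admissible_extend1[c' ? ?]|nadm] := pselect (admissible L p.2 p.1).
    by exists c'.
  by exists p.2.
have [f fP] := choice step.
pose fix s m := if m is m'.+1 then f ((k + m')%N, s m') else c.
have sA m : admissible L (s m) (k + m).
  elim: m => [|m IH]; first by rewrite addn0.
  by rewrite addnS; have [] := fP (_, _) IH.
have sS m : agree (k + m) (s m) (s m.+1) by have [] := fP (_, _) (sA m).
have sle m d : agree (k + m) (s m) (s (m + d)%N).
  elim: d => [|d IH]; first by rewrite addn0.
  by rewrite addnS; apply: agree_trans IH (sS _); rewrite leq_add2l leq_addr.
(* Diagonal limit: the complements of index [i] are final from step [i - k] on; truncated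
   subtraction keeps those of [c] for [i <= k]. *)
pose c' := Choices (fun i => Nc (s (i - k)%N) i) (fun i => Rc (s (i - k)%N) i).
have c'E m : agree (k + m) (s m) c'.
  move=> i lim; have lm : (i - k <= m)%N by rewrite leq_subLR.
  have [] := sle (i - k)%N (m - (i - k))%N i; first by rewrite -leq_subLR.
  by rewrite subnKC // => <- <-.
exists c'; split; first by have := c'E 0%N; rewrite addn0.
move=> n; apply: admissible_agree (admissible_leq (leq_addl k n) (sA n)) => i lin.
by apply: c'E; apply: leq_trans (leq_addl _ _).
Qed.

End Extension.

(** The first two clauses say that a stage makes sense after admissible earlier ones; the third,
    that partial choices extend to all stages, as the last clause assumes. *)
Theorem lemma1 (R : realType) (K : fieldType) (K_RC : real_or_complex R K)
    (B B' : lmodType K) (L : nat -> {linear B -> B'})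
    (L_neq0 : exists i : nat, exists b : B, L i b <> 0) :
  (* the recursion is well defined at every stage k+1 *)
  [/\ forall (k : nat) (c : choices B B'), admissible L c k ->
        [/\ linear (opSbar L c k.+1),
            linear (opS L c k.+1) /\ (forall b, Rc c k (opS L c k.+1 b)),
            forall i, (1 <= i <= k.+1)%N ->
              linear (opE L c i k.+1) /\ linear (opM L c i k.+1),
            exists A, complements (spN L c k) A (spN L c k.+1)
          & exists A, complements (Rc c k) (spR L c k.+1) A],
      forall (k : nat) (c : choices B B'), admissible L c k.+1 ->
        [/\ direct_sum setT (chain (Nc c) (spN L c) k.+1),
            direct_sum setT (chain (spR L c) (Rc c) k.+1),
            linear (projR L c k.+1)
          & set_bij (Nc c k.+1) (spR L c k.+1) (opS L c k.+1)],
      forall (k : nat) (c : choices B B'), admissible L c k ->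
        exists c' : choices B B',
          (forall i, (i <= k)%N -> Nc c' i = Nc c i /\ Rc c' i = Rc c i)
          /\ (forall n, admissible L c' n)
  (* for any choice of complements *)
    & forall c : choices B B', (forall n, admissible L c n) ->
        [/\ (* (i) *)
            forall k : nat,
              [/\ linear (Mmx L c (k := k)),
                  [set v | Delta L (k := k.+1) v = 0]
                  = Mmx L c (k := k) @`
                      selection (fun j : 'I_k.+1 => spN L c j.+1)
                & direct_sum [set v | Delta L (k := k.+1) v = 0]
                    (fun j : 'I_k.+1 => Mcol L c j @` spN L c j.+1)],
            (* (ii) *)
            forall k : nat,
              [/\ forall b0, ((k%:R)%:E <= rank R L b0)%E <-> spN L c k b0,
                  forall b0, rank R L b0 = (k%:R)%:E
                    <-> (spN L c k `\` spN L c k.+1) b0,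
                  Nc c k.+1 `<=` spN L c k
                & forall b0, Nc c k.+1 b0 -> b0 <> 0 ->
                    rank R L b0 = (k%:R)%:E]
          & (* (iii) *)
            forall k : nat,
              [/\ stabilizes_at R L k
                  <-> (Nc c k.+1 <> [set 0]
                       /\ forall l, (2 <= l)%N -> Nc c (k + l)%N = [set 0]),
                  stabilizes_at R L k
                  <-> (spR L c k.+1 <> [set 0]
                       /\ forall l, (2 <= l)%N -> spR L c (k + l)%N = [set 0])
                & stabilizes_at R L k
                  <-> (spN L c k.+1 `<` spN L c k
                       /\ forall l, (2 <= l)%N ->
                            spN L c k.+1 = spN L c (k + l)%N)]]].
Proof.
split.
- move=> k c adm; have [lSb lS lEM] := stage_linear adm (leqnn k).
  split=> //.
  + by split=> // b; apply: (opS_Rc adm).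
  + by case=> // i; rewrite ltnS; apply: lEM.
  + exact: complement_N_exists.
  + exact: complement_R_exists.
- move=> k c adm; split.
  + exact: (chain_N_direct adm).
  + exact: (chain_R_direct adm).
  + exact: (projR_linear adm).
  + apply: (opS_bij adm) => //; exact: (opS_linear adm).
- by move=> k c; apply: admissible_extend.
- move=> c adm; split=> k.
  + split; [exact: Mmx_linear|exact: Delta_kernel|exact: Mcol_direct_sum].
  + split=> [b0|b0||b0].
    * exact: le_rank.
    * exact: rank_eq.
    * exact: complements_subl (admissible_compN (adm k.+1) (ltnSn k)).
    * exact: Nc_rank.
  + split; last exact: stabilizes_spN.
      exact: (stabilizes_step _ adm (Q := fun j => Nc c j = [set 0])
        _ (Nc_trivial adm)).
    exact: (stabilizes_step _ adm (Q := fun j => spR L c j = [set 0])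
      _ (spR_trivial adm)).
Qed.
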